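(* Every $(D,L)$-Bonnet-Myers sharp graph satisfies $L\le D$. Moreover, $L$ divides $2D$.
   Context: All graphs are finite, simple, undirected, unweighted, connected, and have at least one edge. $d$ denotes the combinatorial distance and $\mathrm{diam}(G)=\max_{x,y}d(x,y)$; $x\sim y$ means that $x,y$ are adjacent. For a $D$-regular graph $G=(V,E)$ and $x\in V$, let $\mu_x$ be the probability measure on $V$ giving mass $\frac1{D+1}$ to $x$ and to each of its $D$ neighbours. The Wasserstein distance of probability measures $\mu,\nu$ on $V$ is $W_1(\mu,\nu)=\inf_\pi\sum_{u,v\in V}d(u,v)\pi(u,v)$, where $\pi:V\times V\to[0,1]$ runs over all couplings with marginals $\mu$ and $\nu$. The (modified) Ollivier Ricci curvature of two different vertices $x,y$ is $$\kappa(x,y)=\frac{D+1}{D}\left(1-\frac{W_1(\mu_x,\mu_y)}{d(x,y)}\right).$$ A $D$-regular graph $G$ of diameter $L$ is called $(D,L)$-Bonnet-Myers sharp if $\inf_{x\sim y}\kappa(x,y)=\frac2L$. *)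

(* Defs.v *)
From HB Require Import structures.
From mathcomp Require Import all_boot all_order all_algebra.
From mathcomp Require Import boolp classical_sets reals.

Set Implicit Arguments.
Unset Strict Implicit.
Unset Printing Implicit Defensive.

Import Order.TTheory GRing.Theory Num.Theory.

Local Open Scope classical_set_scope.
Local Open Scope ring_scope.

Definition connected_graph (V : finType) (adj : rel V) : Prop :=
  [/\ symmetric adj, irreflexive adj, forall x y, connect adj x y
    & exists x y, adj x y].

Definition regular_graph (V : finType) (adj : rel V) (D : nat) : Prop :=
  forall x, #|adj x| = D.

Definition walk (V : finType) (adj : rel V) (n : nat) (x y : V) : bool :=
  [exists p : n.-tuple V, path adj x p && (last x p == y)].

(* Shortest walks have fewer than #|V| edges, so bounding n loses nothing;
   #|V| is the junk value for vertices in different components. *)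
Definition gdist (V : finType) (adj : rel V) (x y : V) : nat :=
  \big[minn/#|V|]_(n < #|V| | walk adj n x y) n.

Definition diam (V : finType) (adj : rel V) : nat :=
  (\max_(x : V) \max_(y : V) gdist adj x y)%N.

Section Curvature.
Variables (R : realType) (V : finType) (adj : rel V).

Definition ball_measure (D : nat) (x : V) : V -> R :=
  fun v => if (v == x) || adj x v then (D.+1%:R)^-1 else 0.

Definition coupling (mu nu : V -> R) (pi : V -> V -> R) : Prop :=
  [/\ forall u v, 0 <= pi u v <= 1,
      forall u, \sum_(v : V) pi u v = mu u
    & forall v, \sum_(u : V) pi u v = nu v].

Definition cost (pi : V -> V -> R) : R :=
  \sum_(u : V) \sum_(v : V) (gdist adj u v)%:R * pi u v.

Definition W1 (mu nu : V -> R) : R := inf [set cost pi | pi in coupling mu nu].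

Definition kappa (D : nat) (x y : V) : R :=
  (D.+1%:R / D%:R) *
  (1 - W1 (ball_measure D x) (ball_measure D y) / (gdist adj x y)%:R).

Definition Bonnet_Myers_sharp (D L : nat) : Prop :=
  [/\ regular_graph adj D, diam adj = L
    & inf [set kappa D p.1 p.2 | p in [set p : V * V | adj p.1 p.2]]
      = 2 / L%:R].

End Curvature.

(* Main.v *)
Require Import Defs.
From mathcomp Require Import all_boot all_order all_algebra.
From mathcomp Require Import reals.
From mathcomp Require Import classical_sets.
From mathcomp Require Import ring lra zify.

(** Let [x0] and [z] be at distance [L], write [f v] for the distance from [x0]
    to [v], and let [S x] be the sum of [f] over the closed unit ball of [x], so
    that [S x / (D + 1)] is the mean of [f] for the measure at [x].

    As [f] is 1-Lipschitz, the easy half of Kantorovich duality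
    ([kantorovich_le_W1]) bounds a difference of means from above by [W1], and the
    curvature bound [2 / L] on an edge bounds [W1].  Together they say
    ([ball_sum_edge]) that along an edge [S] grows by at most
    [e = D + 1 - 2 D / L].  A shortest walk from [x0] to [z] has [L] edges, so
    [S z - S x0 <= L e = (D + 1) L - 2 D].  But [S x0 = D], because the ball of
    [x0] is [x0] and [D] vertices at distance 1, and [S z >= (D + 1) L - D],
    because the ball of [z] is [z] and [D] vertices at distance at least
    [L - 1].  This is exactly the tight case: every edge of the walk realises
    the growth [e].

    For the first edge, from [x0] to [x1], the equality reads
    [2 D = L (2 D + 1 - S x1)] with [S x1] an integer, hence [L] divides [2 D].
    Moreover the ball of [x1] contains [x0] and [x1], and its other [D - 1]
    vertices are at distance at most 2, so [S x1 <= 2 D - 1]; the cofactor is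
    thus at least 2 and [L <= D].  (The cofactor is 2 plus the number of
    triangles on the edge.) *)

Set Implicit Arguments.
Unset Strict Implicit.
Unset Printing Implicit Defensive.

Import Order.TTheory GRing.Theory Num.Theory.

Local Open Scope ring_scope.

(** * Graph distance *)

Section Distance.
Variables (V : finType) (adj : rel V).
Local Notation d := (gdist adj).

Lemma walkP (n : nat) (x y : V) :
  reflect (exists p, [/\ path adj x p, last x p = y & size p = n])
          (walk adj n x y).
Proof.
apply: (iffP existsP) => [[p /andP[pP /eqP lP]]|[p [pP lP /eqP sP]]].
  by exists p; rewrite pP lP size_tuple.
by exists (Tuple sP); rewrite /= pP lP eqxx.
Qed.

Lemma gdist_le_card (x y : V) : (d x y <= #|V|)%N.
Proof.
rewrite /gdist; elim/big_rec: _ => // i m _ le_m.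
by rewrite (leq_trans (geq_minr _ _)).
Qed.

Lemma gdist_le_path (x : V) (p : seq V) :
  path adj x p -> (d x (last x p) <= size p)%N.
Proof.
move=> pP; have [lt_p|] := ltnP (size p) #|V|; last first.
  (* Longer walks are outside the range of the minimum. *)
  exact: leq_trans (gdist_le_card _ _).
have wP : walk adj (Ordinal lt_p) x (last x p) by apply/walkP; exists p.
rewrite /gdist; elim: (index_enum _) (mem_index_enum (Ordinal lt_p)) => // i s IH.
rewrite inE big_cons => /orP[/eqP <-|/IH le_s]; first by rewrite wP geq_minl.
by case: ifP => // _; rewrite (leq_trans (geq_minr _ _)).
Qed.

Lemma gdist_geodesic (x y : V) : connect adj x y ->
  exists p, [/\ path adj x p, last x p = y & size p = d x y].
Proof.
case/connectP=> p0 p0P ->{y}; case/shortenP: p0P => p pP uP _.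
have lt_p : (size p < #|V|)%N.
  by have := max_card (mem (x :: p)); rewrite (card_uniqP uP).
(* The default value #|V| of the minimum is excluded by the walk p. *)
have : d x (last x p) = #|V| \/ walk adj (d x (last x p)) x (last x p).
  rewrite {1 2}/gdist; apply: (big_ind (fun m => m = #|V| \/ walk adj m x _)).
  - by left.
  - by move=> a b Ha Hb; rewrite /minn; case: ifP.
  - by move=> i Hi; right.
case=> [eqV|/walkP[q qP]]; last by exists q.
by have := gdist_le_path pP; rewrite eqV leqNgt lt_p.
Qed.

Lemma gdistxx (x : V) : d x x = 0%N.
Proof. by apply/eqP; rewrite -leqn0; apply: (@gdist_le_path x [::]). Qed.

Lemma gdist_adj_le1 (x y : V) : adj x y -> (d x y <= 1)%N.
Proof. by move=> xy; apply: (@gdist_le_path x [:: y]); rewrite /= xy. Qed.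

Hypothesis connected : forall x y, connect adj x y.

Lemma gdist_triangle (x y z : V) : (d x z <= d x y + d y z)%N.
Proof.
have [p [pP <- <-]] := gdist_geodesic (connected x y).
have [q [qP <- <-]] := gdist_geodesic (connected (last x p) z).
by rewrite -last_cat -size_cat; apply: gdist_le_path; rewrite cat_path pP.
Qed.

Lemma gdist_adj (x y : V) : irreflexive adj -> adj x y -> d x y = 1%N.
Proof.
move=> irr xy; apply/eqP; rewrite eqn_leq gdist_adj_le1 // lt0n.
apply/eqP => d0; have [p [_ lP sP]] := gdist_geodesic (connected x y).
by move: sP lP xy; rewrite d0 => /size0nil -> /= ->; rewrite irr.
Qed.

Lemma diam_attained (x : V) : exists y z, d y z = diam adj.
Proof.
have V_gt0 : (0 < #|V|)%N by apply/card_gt0P; exists x.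
have [y Ey] := bigop.eq_bigmax (fun y => \max_z d y z)%N V_gt0.
have [z Ez] := bigop.eq_bigmax (d y) V_gt0.
by exists y, z; rewrite /diam Ey Ez.
Qed.

End Distance.

(** * Kantorovich duality and the growth of ball sums *)

Section Transport.
Variables (R : realType) (V : finType) (adj : rel V).
Local Notation d := (gdist adj).

(** Its existence makes the set of costs nonempty, without which the infimum
    defining [W1] would be a default value. *)
Lemma product_coupling (mu nu : V -> R) :
  (forall u, 0 <= mu u) -> (forall u, 0 <= nu u) ->
  \sum_u mu u = 1 -> \sum_u nu u = 1 ->
  coupling mu nu (fun u v => mu u * nu v).
Proof.
move=> mu0 nu0 mu1 nu1.
have le1 (m : V -> R) : (forall u, 0 <= m u) -> \sum_u m u = 1 ->
    forall u, m u <= 1.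
  by move=> m0 <- u; rewrite (bigD1 u) //= lerDl sumr_ge0.
split=> [u v|u|v].
- by rewrite mulr_ge0 //= mulr_ile1 ?le1.
- by rewrite -mulr_sumr nu1 mulr1.
- by rewrite -mulr_suml mu1 mul1r.
Qed.

(** Integrating [f v - f u <= d u v] against a coupling turns the left-hand
    side into a difference of integrals against the marginals. *)
Lemma kantorovich_le_W1 (f : V -> R) (mu nu : V -> R) :
  (forall u v, f v - f u <= (d u v)%:R) ->
  (forall u, 0 <= mu u) -> (forall u, 0 <= nu u) ->
  \sum_u mu u = 1 -> \sum_u nu u = 1 ->
  \sum_v f v * nu v - \sum_u f u * mu u <= W1 adj mu nu.
Proof.
move=> lip mu0 nu0 mu1 nu1; apply: lb_le_inf.
  by eexists; eexists; [exact: product_coupling mu0 nu0 mu1 nu1|].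
move=> _ [pi [pi01 piL piR] <-].
have -> : \sum_v f v * nu v = \sum_u \sum_v f v * pi u v.
  by rewrite exchange_big; apply: eq_bigr => v _; rewrite -mulr_sumr piR.
have -> : \sum_u f u * mu u = \sum_u \sum_v f u * pi u v.
  by apply: eq_bigr => u _; rewrite -mulr_sumr piL.
rewrite -sumrB; apply: ler_sum => u _; rewrite -sumrB; apply: ler_sum => v _.
by rewrite -mulrBl ler_wpM2r //; case/andP: (pi01 u v).
Qed.

(** The mean over a ball without its normalisation, kept in [nat] because the
    divisibility comes from the integrality of these sums. *)
Definition ball_sum (f : V -> nat) (x : V) : nat :=
  (\sum_(v | (v == x) || adj x v) f v)%N.

Lemma ball_sumE (f : V -> nat) (x : V) : irreflexive adj ->
  ball_sum f x = (f x + \sum_(v | adj x v) f v)%N.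
Proof.
move=> irr; rewrite /ball_sum (bigD1 x) ?eqxx //=; congr addn.
apply: eq_bigl => v; case: eqVneq => [->|_]; last by rewrite andbT.
by rewrite irr andbF.
Qed.

Lemma ball_measure_mean (D : nat) (f : V -> nat) (x : V) :
  \sum_v (f v)%:R * ball_measure R adj D x v = (ball_sum f x)%:R / D.+1%:R.
Proof.
rewrite /ball_sum natr_sum mulr_suml [RHS]big_mkcond; apply: eq_bigr => v _.
by rewrite /ball_measure; case: ifP; rewrite ?mulr0.
Qed.

Lemma ball_measure_sum1 (D : nat) (x : V) :
  irreflexive adj -> regular_graph adj D ->
  \sum_v ball_measure R adj D x v = 1.
Proof.
move=> irr reg; have := ball_measure_mean D (fun=> 1%N) x.
under eq_bigr do rewrite mul1r.
move=> ->; rewrite ball_sumE // sum1_card reg add1n divff //.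
by rewrite pnatr_eq0.
Qed.

(** The infimum in the definition of sharpness is a lower bound because it is
    taken over finitely many edges. *)
Lemma kappa_ge_sharp (D L : nat) (x y : V) :
  Bonnet_Myers_sharp R adj D L -> adj x y -> 2 / L%:R <= kappa R adj D x y.
Proof.
move=> [_ _ <-] xy; apply: ge_inf; last by exists (x, y).
exists (- \sum_(p : V * V) `|kappa R adj D p.1 p.2|) => _ [p _ <-].
rewrite lerNl (le_trans (ler_norm _)) // normrN (bigD1 p) //= lerDl.
exact: sumr_ge0.
Qed.

(** On an edge, the curvature bound [2 / L] says that [W1] is at most
    [1 - 2 D / ((D + 1) L)]; multiplying duality by [D + 1] clears the
    normalisation of the measures. *)
Lemma ball_sum_edge (D L : nat) (f : V -> nat) (x y : V) :
  connected_graph adj -> Bonnet_Myers_sharp R adj D L ->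
  (forall u v, (f v <= f u + d u v)%N) -> adj x y ->
  (ball_sum f y)%:R <= (ball_sum f x)%:R + (D.+1%:R - 2 * D%:R / L%:R) :> R.
Proof.
move=> [_ irr conn _] sharp lip xy; have [reg _ _] := sharp.
have D_gt0 : 0 < D%:R :> R.
  by rewrite ltr0n -(reg x); apply/card_gt0P; exists y.
have D1_gt0 : 0 < D.+1%:R :> R by rewrite ltr0n.
have m0 z u : 0 <= ball_measure R adj D z u.
  by rewrite /ball_measure; case: ifP; rewrite // invr_ge0 ler0n.
have lipR u v : (f v)%:R - (f u)%:R <= (d u v)%:R :> R.
  by rewrite lerBlDl -natrD ler_nat.
have := kantorovich_le_W1 lipR (m0 x) (m0 y)
  (ball_measure_sum1 x irr reg) (ball_measure_sum1 y irr reg).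
have := kappa_ge_sharp sharp xy.
rewrite !ball_measure_mean /kappa (gdist_adj conn irr xy) divr1 -mulrBl.
set W := W1 _ _ _; set S := (ball_sum f y)%:R; set T := (ball_sum f x)%:R.
move=> le_kappa; rewrite ler_pdivrMr // => le_W.
have : 2 / L%:R * D%:R <= D.+1%:R * (1 - W).
  by rewrite -ler_pdivlMr // mulrAC.
rewrite [2 * _ / _]mulrAC; lra.
Qed.

End Transport.

Lemma path_growth (R : realType) (V : finType) (adj : rel V) (g : V -> R)
    (e : R) (x : V) (p : seq V) :
  (forall u v, adj u v -> g v <= g u + e) -> path adj x p ->
  g (last x p) <= g x + (size p)%:R * e.
Proof.
move=> step; elim: p x => [|y p IH] x /=; first by rewrite mul0r addr0.
case/andP=> /step le_y /IH le_last; rewrite -natr1; lra.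
Qed.

(** * Ball sums of the distance from a vertex *)

Section BallSums.
Variables (V : finType) (adj : rel V) (D : nat).
Hypotheses (conn_adj : connected_graph adj) (reg : regular_graph adj D).
Local Notation d := (gdist adj).

Lemma ball_sum_center (x : V) : ball_sum adj (d x) x = D.
Proof.
have [_ irr conn _] := conn_adj; rewrite ball_sumE // gdistxx add0n.
under eq_bigr => v xv do rewrite (gdist_adj conn irr xv).
by rewrite sum1_card reg.
Qed.

Lemma ball_sum_neighbour (x y : V) : adj x y ->
  (ball_sum adj (d x) y < 2 * D)%N.
Proof.
have [sym irr conn _] := conn_adj => xy.
have yx : adj y x by rewrite sym.
rewrite ball_sumE // (gdist_adj conn irr xy) (bigD1 x) //= gdistxx add0n.
have -> : (2 * D = 2 + \sum_(v | adj y v && (v != x)) 2)%N.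
  rewrite -[in LHS](reg y) -sum1_card (bigD1 x) //= mulnDr.
  by rewrite big_distrr.
rewrite -addSn leq_add2l; apply: leq_sum => v /andP[yv _].
apply: leq_trans (gdist_triangle conn x y v) _.
by rewrite (gdist_adj conn irr xy) (gdist_adj conn irr yv).
Qed.

Lemma ball_sum_ge (x z : V) : (D.+1 * d x z <= ball_sum adj (d x) z + D)%N.
Proof.
have [sym irr conn _] := conn_adj.
rewrite ball_sumE // mulSn -addnA leq_add2l.
have {1 2}<- : (\sum_(v | adj z v) 1 = D)%N by rewrite sum1_card reg.
rewrite big_distrl -big_split; apply: leq_sum => v zv /=; rewrite mul1n.
apply: leq_trans (gdist_triangle conn x v z) _.
by rewrite leq_add2l gdist_adj_le1 // sym.
Qed.

End BallSums.

(** * Equality on the first edge of a diametral geodesic *)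

Theorem theorem1p3 (R : realType) (V : finType) (adj : rel V) (D L : nat) :
  connected_graph adj ->
  Bonnet_Myers_sharp R adj D L ->
  (L <= D)%N /\ (L %| 2 * D)%N.
Proof.
move=> conn_adj sharp; have [_ irr conn [a [b ab]]] := conn_adj.
have [reg diamE _] := sharp.
have [x0 [z x0z]] := diam_attained adj a.
have {}x0z : gdist adj x0 z = L by rewrite x0z.
have L_gt0 : (0 < L)%N.
  rewrite -diamE -(gdist_adj conn irr ab) /diam.
  by rewrite (leq_trans _ (bigop.leq_bigmax a)) // (bigop.leq_bigmax b).
have [p [pP lastp sizep]] := gdist_geodesic (conn x0 z).
case: p pP lastp sizep => [_ _|x1 p /= /andP[x01 pP] lastp sizep].
  by rewrite x0z => L0; rewrite -L0 in L_gt0.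
pose S v := ball_sum adj (gdist adj x0) v.
have growth u v : adj u v ->
    (S v)%:R <= (S u)%:R + (D.+1%:R - 2 * D%:R / L%:R) :> R.
  by apply: ball_sum_edge => // s t; apply: gdist_triangle.
have S0 : S x0 = D by apply: ball_sum_center.
have S1 : (S x1 < 2 * D)%N by apply: ball_sum_neighbour.
have Sz : (D.+1 * L <= S z + D)%N by rewrite -x0z; apply: ball_sum_ge.
have S1E : (L * (2 * D + 1 - S x1) = 2 * D)%N.
  apply/eqP; rewrite -(eqr_nat R) natrM natrB; last by lia.
  have L_neq0 : L%:R != 0 :> R by rewrite pnatr_eq0 -lt0n.
  have := growth _ _ x01; have := path_growth growth pP.
  rewrite lastp S0; move: Sz; rewrite -(ler_nat R) !natrD !natrM.
  have -> : (size p)%:R = L%:R - 1 :> R by rewrite -x0z -sizep -natr1 addrK.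
  rewrite -natr1; set c := 2 * D%:R / L%:R.
  have De : L%:R * c = 2 * D%:R by rewrite mulrC divfK.
  (* The lower bound at z leaves no slack: the L - 1 edges after x1 account for
     at most (L - 1) (D + 1 - c) of it, so the first edge reaches its maximum,
     D + 1 - c. *)
  move=> ge_Sz le_Sz le_S1.
  have -> : (S x1)%:R = D%:R + (D%:R + 1 - c) :> R.
    by apply/eqP; rewrite eq_le le_S1 /=; lra.
  by apply/eqP; ring: De.
split; last by rewrite -S1E dvdn_mulr.
have : (L * 2 <= 2 * D)%N by rewrite -[leqRHS]S1E leq_mul2l; lia.
lia.
Qed.
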